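(* Let $G=(V,E)$ be a graph and $c_0\in\mathrm{Circ}(G)$. There exists a linear combination of circuits \[c_0=\sum_{c\in\mathrm{Circ}(G),\,c\ne c_0}s(c)\,c\qquad(s(c)\in\mathbb{R}\text{ for all }c\ne c_0)\] if and only if, for every edge $e$ of $c_0$, there exists a $c\in\mathrm{Circ}(G)\setminus\{c_0\}$ that contains $e$. In this case, the coefficients $s(c)$ $(c\ne c_0)$ can be taken from the set of rational numbers.
   Context: A graph is a pair $G=(V,E)$ with $V$ a finite set and $E\subseteq V\times V$ such that for each $v\in V$ there are edges $(u_1,v),(v,u_2)\in E$ (a finite directed graph). A circuit of $G$ is a closed walk $(v_0,\dots,v_l)$, $l\ge1$, $(v_i,v_{i+1})\in E$, $v_0=v_l$, with $v_0,\dots,v_{l-1}$ pairwise distinct, regarded as a subgraph $c$ with $l$ vertices and edge set $E(c)$ of $l$ edges (so cyclic rotations are identified); $\mathrm{Circ}(G)$ is the set of all circuits of $G$. A circuit $c$ is identified with the vector $\sum_{e\in E(c)}e$ in the real vector space with basis $E$. *)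

(* Defs.v *)
From HB Require Import structures.
From mathcomp Require Import all_boot all_order all_algebra.
From mathcomp Require Import reals.

Set Implicit Arguments.
Unset Strict Implicit.
Unset Printing Implicit Defensive.

Import GRing.Theory.
Local Open Scope ring_scope.

Definition is_graph (V : finType) (E : {set V * V}) : Prop :=
  forall v : V, exists u1 u2 : V, (u1, v) \in E /\ (v, u2) \in E.

Definition edge_rel (V : finType) (E : {set V * V}) : rel V :=
  [rel u v | (u, v) \in E].

(* (vertex set, edge set) *)
Definition subgraph (V : finType) : finType := ({set V} * {set V * V})%type.

Definition vertices (V : finType) (c : subgraph V) : {set V} := c.1.
Definition edges (V : finType) (c : subgraph V) : {set V * V} := c.2.

(* The closed walk (v_0, ..., v_l) with v_l = v_0 is encoded by the sequence
   p = [:: v_0; ...; v_{l-1}]; [next p] is the cyclic successor along p. *)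
Definition walk_subgraph (V : finType) (p : seq V) : subgraph V :=
  ([set v in p], [set (v, next p v) | v in p]).

(* A circuit has pairwise distinct vertices, hence length at most #|V|; the
   bound only serves to let the walks range over a finite type, see [CircP]. *)
Definition Circ (V : finType) (E : {set V * V}) : {set subgraph V} :=
  [set walk_subgraph p | p : #|V|.-bseq V
     & (p != [::] :> seq V) && ucycleb (edge_rel E) p].

Lemma CircP (V : finType) (E : {set V * V}) (c : subgraph V) :
  reflect (exists p : seq V,
             [/\ p != [::], cycle (edge_rel E) p, uniq p & c = walk_subgraph p])
          (c \in Circ E).
Proof.
apply: (iffP imsetP) => [[p + ->] | [p [p0 pE pU ->]]].
  by rewrite inE => /andP[p0 /andP[pE pU]]; exists p.
have sp : (size p <= #|V|)%N by rewrite -(card_uniqP pU) max_card.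
by exists (Bseq sp) => //; rewrite inE /= p0 /ucycleb pE pU.
Qed.

Definition edge_type (V : finType) (E : {set V * V}) : finType :=
  {e : V * V | e \in E}.

(* The real vector space with basis E. *)
Definition edge_space (R : realType) (V : finType) (E : {set V * V}) :
  lmodType R := {ffun edge_type E -> R^o}.

Definition edge_vec (R : realType) (V : finType) (E : {set V * V})
    (e : edge_type E) : edge_space R E :=
  [ffun f => (f == e)%:R].

Definition circuit_vec (R : realType) (V : finType) (E : {set V * V})
    (c : subgraph V) : edge_space R E :=
  \sum_(e : edge_type E | val e \in edges c) edge_vec R e.

(* Main.v *)
Require Import Defs.
From HB Require Import structures.
From mathcomp Require Import all_boot all_order all_algebra.
From mathcomp Require Import reals.

Set Implicit Arguments.
Unset Strict Implicit.
Unset Printing Implicit Defensive.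

Import GRing.Theory.
Local Open Scope ring_scope.

(** The coefficients come from an identity between nonnegative flows.  If every
    edge of [c0] lies on another circuit, then the sum of all the other circuits
    dominates [c0] edge by edge, so their difference
      [f = \sum_(c != c0) c - c0]
    has nonnegative integer entries.  It is conserved at every vertex because
    each circuit is, hence it splits as [f = \sum_c n c * c] with natural [n c]
    ([circulation_decomposition]: as long as a circulation is nonzero, its
    support contains a circuit, which can be subtracted).  The circuit [c0]
    may well reappear in this decomposition, but with a coefficient of the
    harmless sign: collecting terms,
      [(n c0 + 1) c0 = \sum_(c != c0) (1 - n c) c],
    and [n c0 + 1 > 0] can be divided out, which leaves rational coefficients.
    Conversely, comparing the coordinates of both sides at an edge of [c0]
    shows that some other circuit has a nonzero coordinate there. *)

Section Circuits.
Local Open Scope nat_scope.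
Context {V : finType}.
Implicit Types (E F : {set V * V}) (c : subgraph V) (f : V * V -> nat).

Lemma mem_edges_walk (p : seq V) (v w : V) :
  ((v, w) \in edges (walk_subgraph p)) = (v \in p) && (w == next p v).
Proof.
apply/imsetP/andP => [[u up [-> ->]]|[vp /eqP->]]; last by exists v.
by split.
Qed.

Lemma edges_sub E c : c \in Circ E -> edges c \subset E.
Proof.
case/CircP=> p [_ pE _ ->]; apply/subsetP=> -[v w].
by rewrite mem_edges_walk => /andP[vp /eqP->]; apply: (next_cycle pE).
Qed.

Lemma edges_neq0 E c : c \in Circ E -> exists e, e \in edges c.
Proof.
case/CircP=> p [+ _ _ ->]; case: p => // v p _; exists (v, next (v :: p) v).
by rewrite mem_edges_walk mem_head eqxx.
Qed.

Lemma Circ_mono F E : F \subset E -> Circ F \subset Circ E.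
Proof.
move=> /subsetP sFE; apply/subsetP=> c /CircP[p [p0 pF Up ->]].
apply/CircP; exists p; split=> //.
by apply: sub_cycle pF => v w; apply: sFE.
Qed.

(** Following a chosen out-edge forever must eventually repeat a vertex, since
    there are finitely many; the periodic part of that trajectory is a
    circuit. *)
Lemma exists_circuit F :
    (forall v w, (v, w) \in F -> exists u, (w, u) \in F) ->
  F != set0 -> exists c, c \in Circ F.
Proof.
move=> outF /set0Pn[[v0 x] Fx].
pose g v := odflt v [pick w | (v, w) \in F].
have gF v w : (v, w) \in F -> (w, g w) \in F.
  move=> /outF[u Fu]; rewrite /g; case: pickP => [//|/(_ u)].
  by rewrite Fu.
have iterF k : (iter k g x, iter k.+1 g x) \in F.
  by elim: k => [|k IHk]; [apply: gF Fx | apply: gF IHk].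
have /trajectP[i lt_i_n eq_n_i] := looping_order g x.
set y := iter i g x in eq_n_i.
have y_cyc : fcycle g (orbit g y).
  apply/(orbitPcycle 3 0); exists (order g x - i).-1.
  by rewrite prednK ?subn_gt0 // /y -iterD subnK // ltnW.
exists (walk_subgraph (orbit g y)); apply/CircP; exists (orbit g y); split.
- by apply/eqP=> y0; have := in_orbit g y; rewrite y0.
- apply: (sub_in_cycle (P := mem (orbit g y))) y_cyc; last exact/allP.
  move=> u v uy _ /eqP<-.
  have /iter_findex <-: fconnect g y u by rewrite fconnect_orbit.
  by rewrite -iterS /y -!iterD; apply: iterF.
- exact: orbit_uniq.
- by [].
Qed.

Definition circulation f :=
  forall v, \sum_w f (v, w) = \sum_w f (w, v).

Lemma circuit_circulation E c :
  c \in Circ E -> circulation (fun e => (e \in edges c) : nat).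
Proof.
case/CircP=> p [_ _ Up ->] v.
(* Both sides count the visits of the circuit to [v], which is 0 or 1. *)
transitivity (v \in p : nat).
  under eq_bigr do rewrite mem_edges_walk.
  case: (v \in p) => /=; last by rewrite big1.
  by rewrite (bigD1 (next p v)) //= eqxx big1 // => w /negPf->.
under eq_bigr => w _.
  rewrite mem_edges_walk eq_sym (can2_eq (prev_next Up) (next_prev Up)).
  over.
rewrite -(mem_prev p); case: (boolP (prev p v \in p)) => vp.
  rewrite (bigD1 (prev p v)) //= vp eqxx big1 // => w.
  by move=> /negPf->; rewrite andbF.
by rewrite big1 // => w _; case: eqP => [->|]; rewrite ?(negPf vp) ?andbF.
Qed.

Lemma circulation_sum (I : finType) (P : pred I) (f : I -> V * V -> nat) :
  (forall i, P i -> circulation (f i)) ->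
  circulation (fun e => \sum_(i | P i) f i e).
Proof.
move=> fP v; rewrite exchange_big [RHS]exchange_big /=.
by apply: eq_bigr => i /fP.
Qed.

Lemma circulation_sub (f g : V * V -> nat) :
    circulation f -> circulation g -> (forall e, g e <= f e) ->
  circulation (fun e => f e - g e).
Proof. by move=> fP gP le_gf v; rewrite !sumnB // fP gP. Qed.

(** By conservation an edge of the support is followed by another one, so a
    nonzero circulation has a circuit in its support; subtracting it lowers the
    total flow. *)
Lemma circulation_decomposition E f :
    circulation f -> (forall e, 0 < f e -> e \in E) ->
  exists n : subgraph V -> nat,
    forall e, f e = \sum_(c in Circ E) n c * (e \in edges c).
Proof.
have [m] := ubnP (\sum_e f e); elim: m f => // m IHm f.
rewrite ltnS => le_f_m circf suppf.
pose F := [set e | 0 < f e].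
have [F0 | F_neq0] := eqVneq F set0.
  exists (fun=> 0) => e; rewrite big1 //.
  by apply/eqP; have := in_set0 e; rewrite -F0 inE lt0n => /negbFE.
have [v w|c cF] := exists_circuit _ F_neq0.
  rewrite inE => fvw; have: 0 < \sum_u f (w, u).
    by rewrite circf (bigD1 v) //= addn_gt0 fvw.
  rewrite lt0n sum_nat_eq0 negb_forall => /existsP[u]; rewrite -lt0n => fu.
  by exists u; rewrite inE.
have le_c_f e : (e \in edges c) <= f e.
  by case: (boolP (e \in _)) => // /(subsetP (edges_sub cF)); rewrite inE.
have cE : c \in Circ E.
  by apply: subsetP cF; apply/Circ_mono/subsetP => e; rewrite inE => /suppf.
have [|||n nP] := IHm (fun e => f e - (e \in edges c)).
- apply: leq_trans le_f_m; rewrite sumnB // ltn_subrL.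
  have [e ec] := edges_neq0 cF.
  have c_gt0 : 0 < \sum_e (e \in edges c) by rewrite (bigD1 e) //= ec.
  by rewrite c_gt0 (leq_trans c_gt0) // leq_sum.
- exact: circulation_sub circf (circuit_circulation cF) le_c_f.
- by move=> e; rewrite subn_gt0 => /(leq_ltn_trans (leq0n _))/suppf.
exists (fun d => n d + (d == c)) => e.
under eq_bigr do rewrite mulnDl.
rewrite big_split /= -nP [X in _ + X](bigD1 c) //= eqxx mul1n big1 ?addn0.
  by rewrite subnK.
by move=> d /andP[_ /negPf->].
Qed.

End Circuits.

Lemma circuit_vecE (R : realType) (V : finType) (E : {set V * V})
    (c : subgraph V) (e : edge_type E) :
  (circuit_vec R E c : {ffun edge_type E -> R}) e = (val e \in edges c)%:R.
Proof.
rewrite /circuit_vec sum_ffunE.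
under eq_bigr do rewrite ffunE.
case: (boolP (val e \in edges c)) => ec.
  rewrite (bigD1 e) //= eqxx big1 ?addr0 // => d /andP[_].
  by rewrite eq_sym => /negPf->.
by rewrite big1 // => d dc; case: eqP ec => // ->; rewrite dc.
Qed.

Lemma circuit_combinationE (R : realType) (V : finType) (E : {set V * V})
    (P : pred (subgraph V)) (s : subgraph V -> R) (e : edge_type E) :
  (\sum_(c | P c) s c *: circuit_vec R E c : {ffun edge_type E -> R}) e =
    \sum_(c | P c) s c * (val e \in edges c)%:R.
Proof.
rewrite sum_ffunE; apply: eq_bigr => c _.
by rewrite ffunE -[in RHS]circuit_vecE.
Qed.

(** Decomposing the circulation [\sum_(c != c0) c - c0] over the natural numbers
    gives [(n c0 + 1) c0 = \sum_(c != c0) (1 - n c) c]; moving the terms [n c]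
    to the left avoids truncated subtraction. *)
Lemma covered_circuit_relation (V : finType) (E : {set V * V})
    (c0 : subgraph V) (hc0 : c0 \in Circ E) :
    (forall e, e \in edges c0 ->
       exists c, c \in Circ E :\ c0 /\ e \in edges c) ->
  exists n : subgraph V -> nat, forall e,
    ((n c0).+1 * (e \in edges c0) +
       \sum_(c in Circ E | c != c0) n c * (e \in edges c) =
     \sum_(c in Circ E | c != c0) (e \in edges c))%N.
Proof.
move=> cov.
pose g e := (\sum_(c in Circ E | c != c0) (e \in edges c))%N.
have le_c0_g e : ((e \in edges c0) <= g e)%N.
  case: (boolP (e \in edges c0)) => // /cov[c []].
  rewrite in_setD1 => /andP[cc0 cE] ec.
  by rewrite /g (bigD1 c) ?cE //= ec.
have [||n nP] := @circulation_decomposition V E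
  (fun e => g e - (e \in edges c0))%N.
- apply: circulation_sub (circuit_circulation hc0) le_c0_g.
  by apply: circulation_sum => c /andP[cE _]; apply: circuit_circulation cE.
- move=> e; rewrite subn_gt0 => /(leq_ltn_trans (leq0n _)).
  rewrite lt0n sum_nat_eq0 negb_forall => /existsP[c].
  rewrite negb_imply => /andP[/andP[cE _]]; rewrite eqb0 negbK => ec.
  exact: subsetP (edges_sub cE) e ec.
exists n => e; rewrite -/(g e) -(subnK (le_c0_g e)) nP [in RHS](bigD1 c0) //=.
by rewrite mulSn -addnA addnC.
Qed.

Lemma rational_combination (R : realType) (V : finType) (E : {set V * V})
    (c0 : subgraph V) (hc0 : c0 \in Circ E) :
    (forall e, e \in edges c0 ->
       exists c, c \in Circ E :\ c0 /\ e \in edges c) ->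
  exists q : subgraph V -> rat,
    circuit_vec R E c0 =
      \sum_(c in Circ E | c != c0) ratr (q c) *: circuit_vec R E c.
Proof.
move=> /(covered_circuit_relation hc0)[n nP].
exists (fun c => (1 - (n c)%:R) / (n c0).+1%:R); apply/ffunP=> e.
rewrite circuit_vecE circuit_combinationE.
under eq_bigr do rewrite fmorph_div rmorphB rmorph1 !rmorph_nat mulrAC.
rewrite -mulr_suml.
apply: canRL (mulfK _) _; first by rewrite Num.Theory.pnatr_eq0.
under eq_bigr do rewrite mulrBl mul1r -natrM.
by rewrite big_split /= sumrN -!natr_sum -nP natrD addrK mulnC natrM.
Qed.

Theorem theorem5p1 (R : realType) (V : finType) (E : {set V * V})
  (hG : is_graph E) (c0 : subgraph V) (hc0 : c0 \in Circ E) :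
  ((exists s : subgraph V -> R,
      circuit_vec R E c0 =
        \sum_(c in Circ E | c != c0) s c *: circuit_vec R E c)
   <->
   (forall e : V * V, e \in edges c0 ->
      exists c : subgraph V, c \in Circ E :\ c0 /\ e \in edges c))
  /\
  ((exists s : subgraph V -> R,
      circuit_vec R E c0 =
        \sum_(c in Circ E | c != c0) s c *: circuit_vec R E c) ->
   exists q : subgraph V -> rat,
     circuit_vec R E c0 =
       \sum_(c in Circ E | c != c0) ratr (q c) *: circuit_vec R E c).
Proof.
have covered : (exists s : subgraph V -> R,
      circuit_vec R E c0 =
        \sum_(c in Circ E | c != c0) s c *: circuit_vec R E c) ->
    forall e, e \in edges c0 -> exists c, c \in Circ E :\ c0 /\ e \in edges c.
  case=> s def_c0 e ec0.
  have [/existsP[c /andP[cE ec]]|nocov] :=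
    boolP [exists c, (c \in Circ E :\ c0) && (e \in edges c)].
    by exists c.
  (* Otherwise the coordinate of [c0] at [e] would be 0 instead of 1. *)
  have eE : e \in E := subsetP (edges_sub hc0) e ec0.
  have /ffunP/(_ (exist _ e eE)) := def_c0.
  rewrite circuit_vecE circuit_combinationE /= ec0 big1 => [/eqP|c].
    by rewrite oner_eq0.
  move=> /andP[cE cc0]; move: nocov; rewrite negb_exists => /forallP/(_ c).
  by rewrite in_setD1 cc0 cE /= => /negPf->; rewrite mulr0.
split=> [|/covered cov]; last exact: rational_combination.
split=> // /(rational_combination R hc0)[q def_c0].
by exists (ratr \o q).
Qed.
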